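(* Let $K$ be a finite oriented simplicial complex and $q=p+1$. There is an integral input chain $\mathbf{c}\in\mathbb{Z}^m$ such that the OHCP LP over $K$ with input chain $\mathbf{c}$ has a nonintegral basic solution if and only if there is some $i\in\{1,\dots,m\}$ such that OHCP$_i$ has a nonintegral basic solution. Moreover, whenever the OHCP LP with integral input chain $\mathbf{c}$ has a nonintegral basic solution, such an $i$ can be chosen with the $i$th coefficient of $\mathbf{c}$ nonzero.
   Context: Setting. $K$ is a finite simplicial complex of dimension $d$ with oriented simplices; $q=p+1$ with $1\le q\le d$; $K$ has $m$ $p$-simplices and $n$ $q$-simplices. $B=[\partial_q]$ is the $m\times n$ boundary matrix (rows indexed by $p$-simplices, columns by $q$-simplices; an entry is $0$ if the $p$-simplex is not a face of the $q$-simplex, $1$ if its orientation agrees with the one induced by the $q$-simplex, and $-1$ otherwise). Put $A=[\,I\ \ -I\ \ -B\ \ B\,]\in\mathbb{Z}^{m\times 2(m+n)}$. For an input chain $\mathbf{c}\in\mathbb{R}^m$ and nonnegative weights $\mathbf{w}\in\mathbb{R}^m$, the OHCP LP is: minimize $[\mathbf{w}^T\ \mathbf{w}^T\ \mathbf{0}^T\ \mathbf{0}^T]\,\mathbf{z}$ subject to $A\mathbf{z}=\mathbf{c}$, $\mathbf{z}\ge\mathbf{0}$, $\mathbf{z}\in\mathbb{R}^{2(m+n)}$. Let $P_A=\{\mathbf{z}:A\mathbf{z}=\mathbf{c}\}$. A basic solution is a point $\mathbf{z}\in P_A$ (not necessarily nonnegative) at which $2(m+n)$ linearly independent constraints among $A\mathbf{z}=\mathbf{c}$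 and $\mathbf{z}\ge\mathbf{0}$ are active, i.e. hold with equality. OHCP$_i$ is the OHCP LP with input chain the unit vector $\mathbf{e}_i$. ''Integral'' means all coordinates are integers. *)

(* Defs.v *)
From mathcomp Require Import all_boot all_order all_fingroup all_algebra.
From mathcomp Require Import reals.

Set Implicit Arguments.
Unset Strict Implicit.
Unset Printing Implicit Defensive.

Import Order.TTheory GRing.Theory Num.Theory.
Local Open Scope ring_scope.

Record simplicial_complex (V : finType) := SimplicialComplex {
  simplices :> {set {set V}};
  simplex_neq0 : set0 \notin simplices;
  face_closed : forall s t : {set V},
    s \in simplices -> t \subset s -> t != set0 -> t \in simplices
}.

(* An orientation of a simplex is an ordering of its vertices up to even
   permutations; [ordering] picks a representative for each simplex, and is
   only ever compared up to [same_orientation]. *)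
Record oriented_complex (V : finType) := OrientedComplex {
  complex_of :> simplicial_complex V;
  ordering : {set V} -> seq V;
  ordering_perm : forall s, s \in simplices complex_of ->
    perm_eq (ordering s) (enum s)
}.

(* On duplicate-free [s] and [t] with the same elements, the permutation of
   these elements that maps [s] to [t] is unique; it has the same parity as the
   corresponding permutation of positions. *)
Definition same_orientation (V : finType) (s t : seq V) : bool :=
  [exists f : {perm V},
    [&& perm_on [set x in s] f, ~~ odd_perm f & map f s == t]].

Definition psimplices (V : finType) (K : simplicial_complex V) (p : nat) :
  {set {set V}} := [set s in simplices K | #|s| == p.+1].

Definition complex_dim (V : finType) (K : simplicial_complex V) : nat :=
  \max_(s in simplices K) #|s|.-1.

(* If [t] is oriented by (v_0, ..., v_q), the orientation it induces on the
   facet [t :\ v_j] is (-1)^j (v_0, ..., v_(j-1), v_(j+1), ..., v_q), where the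
   sign -1 stands for the opposite orientation. *)
Definition induces_orientation (V : finType) (K : oriented_complex V)
    (t s : {set V}) : bool :=
  [exists v in t, (s == t :\ v) &&
    (odd (index v (ordering K t))
     (+) same_orientation (rem v (ordering K t)) (ordering K s))].

Definition boundary_mx (V : finType) (K : oriented_complex V) (p : nat) :
    'M[int]_(#|psimplices K p|, #|psimplices K p.+1|) :=
  \matrix_(i, j)
    let s : {set V} := enum_val i in
    let t : {set V} := enum_val j in
    if ~~ (s \subset t) then 0
    else if induces_orientation K t s then 1 else -1.

(* minimize [lp_cost *m z] subject to [lp_mx *m z = lp_rhs] and [z >= 0] *)
Record standard_lp (R : realType) (m N : nat) := StandardLP {
  lp_cost : 'rV[R]_N;
  lp_mx : 'M[R]_(m, N);
  lp_rhs : 'cV[R]_m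
}.

(* The constraints of the LP are the rows of [A z = c] followed by the [N] rows
   of [I z >= 0]. No nonnegativity of [z] is required. *)
Definition lp_constraints (R : realType) (m N : nat) (L : standard_lp R m N) :
  'M[R]_(m + N, N) := col_mx (lp_mx L) 1%:M.

Definition lp_bounds (R : realType) (m N : nat) (L : standard_lp R m N) :
  'cV[R]_(m + N) := col_mx (lp_rhs L) 0.

Definition lp_active (R : realType) (m N : nat) (L : standard_lp R m N)
    (z : 'cV[R]_N) (k : 'I_(m + N)) : Prop :=
  (lp_constraints L *m z) k 0 = lp_bounds L k 0.

Definition basic_solution (R : realType) (m N : nat) (L : standard_lp R m N)
    (z : 'cV[R]_N) : Prop :=
  lp_mx L *m z = lp_rhs L /\
  exists f : 'I_N -> 'I_(m + N),
    row_free (rowsub f (lp_constraints L)) /\ forall k, lp_active L z (f k).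

Definition has_nonintegral_basic_solution (R : realType) (m N : nat)
    (L : standard_lp R m N) : Prop :=
  exists z, basic_solution L z /\ z \isn't a mxOver Num.int.

Definition ohcp_mx (V : finType) (K : oriented_complex V) (p : nat) :
    'M[int]_(#|psimplices K p|,
             (#|psimplices K p| + #|psimplices K p|)
             + (#|psimplices K p.+1| + #|psimplices K p.+1|)) :=
  row_mx (row_mx 1%:M (- 1%:M)) (row_mx (- boundary_mx K p) (boundary_mx K p)).

Definition ohcp_lp (R : realType) (V : finType) (K : oriented_complex V)
    (p : nat) (w c : 'cV[R]_#|psimplices K p|) :=
  StandardLP (row_mx (row_mx w^T w^T) (row_mx 0 0))
             (map_mx intr (ohcp_mx K p)) c.

Definition ohcp_unit_lp (R : realType) (V : finType) (K : oriented_complex V)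
    (p : nat) (w : 'cV[R]_#|psimplices K p|) (i : 'I_#|psimplices K p|) :=
  ohcp_lp w (delta_mx i 0).

(* Main.v *)
(** The support of a basic solution indexes independent columns of the
    constraint matrix [A], and [A] has full row rank, so this support extends to
    a column basis. The solutions supported on this basis depend linearly on the
    right-hand side, through a right inverse [X] of [A]: the given solution is
    [X c], the sum of the [c_i X e_i], and each [X e_i] is a basic solution for
    [e_i]. If [X c] is nonintegral and [c] is integral, then some [X e_i] with
    [c_i != 0] is nonintegral. *)

Require Import Defs.
From mathcomp Require Import all_boot all_order all_fingroup all_algebra.
From mathcomp Require Import reals.

Set Implicit Arguments.
Unset Strict Implicit.
Unset Printing Implicit Defensive.

Import Order.TTheory GRing.Theory Num.Theory.
Local Open Scope ring_scope.

(* The system [A *m z = 0, z j 0 = 0 for j in S]; the rows outside [S] are kept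
   as zero rows, so that the dimensions do not depend on [S]. *)
Definition vanishing_mx (F : fieldType) (m N : nat) (A : 'M[F]_(m, N))
    (S : {set 'I_N}) : 'M[F]_(m + N, N) :=
  col_mx A (diag_mx (\row_j (j \in S)%:R)).

Lemma not_row_full_ker (F : fieldType) (m N : nat) (A : 'M[F]_(m, N)) :
  ~~ row_full A -> exists2 v : 'cV_N, A *m v = 0 & v != 0.
Proof.
move=> notfull; have /matrix0Pn[k [l nz]] : cokermx A != 0.
  rewrite -mxrank_eq0 mxrank_coker subn_eq0.
  by apply: contra notfull => ?; rewrite /row_full eqn_leq rank_leq_col.
exists (col l (cokermx A)); first by rewrite colE mulmxA mulmx_coker mul0mx.
by apply/matrix0Pn; exists k, 0; rewrite mxE.
Qed.

Lemma row_full_inj (F : fieldType) (m N : nat) (A : 'M[F]_(m, N)) :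
  reflect (forall v : 'cV_N, A *m v = 0 -> v = 0) (row_full A).
Proof.
apply: (iffP idP) => [/row_fullP[B BA] v Av0 | inj].
  by rewrite -[v]mul1mx -BA -mulmxA Av0 mulmx0.
by apply/negPn/negP => /not_row_full_ker[v /inj->]; rewrite eqxx.
Qed.

Lemma vanishing_mxP (F : fieldType) (m N : nat) (A : 'M[F]_(m, N))
    (S : {set 'I_N}) (v : 'cV_N) :
  vanishing_mx A S *m v = 0 <-> A *m v = 0 /\ {in S, forall j, v j 0 = 0}.
Proof.
rewrite /vanishing_mx mul_col_mx -[0]col_mx0; split.
  case/eq_col_mx => Av0 /matrixP Dv0; split=> // j jS.
  by have := Dv0 j 0; rewrite mul_diag_mx !mxE jS mul1r.
case=> -> vS; congr col_mx; apply/matrixP => j k.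
rewrite mul_diag_mx !mxE (ord1 k).
by case: (boolP (j \in S)) => [/vS->|_]; rewrite ?mulr0 ?mul0r.
Qed.

(** In other words, the columns of [A] outside [S] are linearly independent. *)
Lemma row_full_vanishing_mxP (F : fieldType) (m N : nat) (A : 'M[F]_(m, N))
    (S : {set 'I_N}) :
  reflect (forall v : 'cV_N, A *m v = 0 -> {in S, forall j, v j 0 = 0} -> v = 0)
          (row_full (vanishing_mx A S)).
Proof.
apply: (iffP (row_full_inj _)) => inj v.
  by move=> Av0 vS; apply: inj; apply/vanishing_mxP.
by case/vanishing_mxP; apply: inj.
Qed.

(* Minimality of [S] gives, for each [j] in [S], a kernel vector of [A] whose
   only nonzero coordinate in [S] is the [j]-th; subtracting multiples of these
   clears the coordinates in [S] of any vector. *)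
Lemma minset_vanishing_solution (F : fieldType) (m N : nat) (A : 'M[F]_(m, N))
    (S : {set 'I_N}) (u : 'cV_N) :
  minset (fun S => row_full (vanishing_mx A S)) S ->
  exists2 z : 'cV_N, A *m z = A *m u & {in S, forall j, z j 0 = 0}.
Proof.
case/minsetP => /row_full_vanishing_mxP injS minS.
have /fin_all_exists[v vP] j : exists v : 'cV_N, j \in S ->
    A *m v = 0 /\ {in S, forall k, v k 0 = (k == j)%:R}.
  case: (boolP (j \in S)) => [jS|_]; last by exists 0.
  have : ~~ row_full (vanishing_mx A (S :\ j)).
    apply/negP => /minS/(_ (subD1set S j)) eqS.
    by have := setD11 j S; rewrite eqS jS.
  case/not_row_full_ker => v /vanishing_mxP[Av0 vS] v_neq0.
  have vj : v j 0 != 0.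
    apply: contraNneq v_neq0 => vj0; apply/eqP/injS => // k kS.
    by have [->|ne] := eqVneq k j; [|apply: vS; rewrite !inE ne].
  exists ((v j 0)^-1 *: v) => _; split; first by rewrite -scalemxAr Av0 scaler0.
  move=> k kS; rewrite mxE; have [->|ne] := eqVneq k j; first by rewrite mulVf.
  by rewrite (vS k) ?mulr0 // !inE ne.
exists (u - \sum_(j in S) u j 0 *: v j).
  rewrite mulmxBr mulmx_sumr big1 ?subr0 // => j jS.
  by rewrite -scalemxAr (vP j jS).1 scaler0.
move=> k kS; rewrite !mxE summxE (bigD1 k) //= big1 => [|j /andP[jS ne]].
  by rewrite mxE (vP k kS).2 // eqxx mulr1 addr0 subrr.
by rewrite mxE (vP j jS).2 // eq_sym (negPf ne) mulr0.
Qed.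

(** The constraints active at a solution are all rows of the equality system and the unit rows of
    the zero coordinates; [N] independent ones exist exactly when together they have rank [N]. *)
Lemma basic_solutionP (R : realType) (m N : nat) (L : standard_lp R m N)
    (z : 'cV[R]_N) :
  basic_solution L z <->
  lp_mx L *m z = lp_rhs L /\
  row_full (vanishing_mx (lp_mx L) [set j | z j 0 == 0]).
Proof.
set S := [set j | _]; split=> -[Az Hz]; split=> //.
  case: Hz => f [free act].
  have eqf : rowsub f (vanishing_mx (lp_mx L) S)
      = rowsub f (lp_constraints L).
    apply/matrixP => k l; rewrite !mxE; have := act k; rewrite /lp_active.
    case: splitP => [i _ //|j /= fk].
    have -> : f k = rshift m j by apply: val_inj.
    rewrite /lp_constraints /lp_bounds mul_col_mx !col_mxEd mul1mx !mxE => zj.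
    by rewrite inE zj eqxx.
  rewrite /row_full eqn_leq rank_leq_col -{1}(eqP free) -eqf.
  exact: mxrankS (rowsub_sub _ _).
exists (fullrankfun Hz); set f := fullrankfun Hz.
(* The rows selected by [f] are independent, so none of them is a zero row kept for an index outside
   [S]. *)
have fS k j : f k = rshift m j -> j \in S.
  move=> fk; apply: contraT => jS.
  have full := fullrowsub_free Hz; rewrite -/f in full.
  have /row_freeP[B /matrixP/(_ k k)] := full.
  rewrite !mxE eqxx big1 => [/esym/eqP|l _]; first by rewrite oner_eq0.
  rewrite [X in X * _](_ : _ = 0) ?mul0r // mxE fk col_mxEd !mxE.
  by rewrite (negPf jS) mul0rn.
split.
  have := fullrowsub_free Hz; rewrite -/f; congr (is_true (row_free _)).
  apply/matrixP => k l; rewrite !mxE.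
  case: splitP => [i _ //|j /= fk].
  have /fS jS : f k = rshift m j by apply: val_inj.
  by rewrite !mxE jS.
move=> k; rewrite /lp_active /lp_constraints /lp_bounds mul_col_mx Az mul1mx.
rewrite !mxE; case: splitP => [i _ //|j /= fk].
have /fS : f k = rshift m j by apply: val_inj.
by rewrite inE mxE => /eqP.
Qed.

Lemma nonintegral_basic_solution_unit (R : realType) (m N : nat)
    (a : 'rV[R]_N) (A : 'M[R]_(m, N)) (Ar : 'M[R]_(N, m)) (c : 'cV[R]_m) :
  A *m Ar = 1%:M -> c \is a mxOver Num.int ->
  has_nonintegral_basic_solution (StandardLP a A c) ->
  exists i, c i 0 != 0 /\
    has_nonintegral_basic_solution (StandardLP a A (delta_mx i 0)).
Proof.
move=> AAr c_int [z [/basic_solutionP[/= Az full] z_nint]].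
(* Shrinking the zero set of [z] extends its support to a column basis, the complement of [S]. *)
have [S minS subS] :=
  minset_exists (P := fun S => row_full (vanishing_mx A S)) full.
have fullS := minsetp minS; have /row_full_vanishing_mxP injS := fullS.
(* Column [i] of [Ar] solves the system for the [i]th unit vector; clearing its coordinates in [S]
   gives [x i]. *)
have /fin_all_exists[x xP] i : exists x : 'cV[R]_N,
    A *m x = delta_mx i 0 /\ {in S, forall j, x j 0 = 0}.
  have [x Ax xS] := minset_vanishing_solution (col i Ar) minS.
  exists x; split=> //; rewrite Ax colE mulmxA AAr -colE.
  by apply/matrixP => j k; rewrite !mxE (ord1 k) eqxx andbT.
have zE : z = \sum_i c i 0 *: x i.
  (* The difference of the two sides lies in the kernel of [A] and vanishes on [S]. *)
  apply/eqP; rewrite -subr_eq0; apply/eqP/injS.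
    rewrite mulmxBr Az mulmx_sumr {1}[c]matrix_sum_delta.
    apply/eqP; rewrite subr_eq0; apply/eqP/eq_bigr => i _.
    by rewrite big_ord1 -scalemxAr (xP i).1.
  move=> j jS; have := subsetP subS j jS; rewrite inE !mxE summxE => /eqP->.
  by rewrite big1 ?subrr // => i _; rewrite mxE (xP i).2 ?mulr0.
have /existsP[i /andP[ci xi]] :
    [exists i, (c i 0 != 0) && (x i \isn't a mxOver Num.int)].
  apply: contraNT z_nint => /existsPn x_int.
  apply/mxOverP => j k; rewrite zE summxE; apply: rpred_sum => i _; rewrite mxE.
  have := x_int i; rewrite negb_and !negbK.
  case/orP => [/eqP->|/mxOverP x_i]; first by rewrite mul0r rpred0.
  by rewrite rpredM ?x_i // (mxOverP c_int).
exists i; split=> //; exists (x i); split=> //; apply/basic_solutionP.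
split=> /=; first exact: (xP i).1.
(* The zero set of [x i] contains [S], so independence of the columns outside [S] passes to its
   support. *)
apply/row_full_vanishing_mxP => v Av0 vx; apply: injS => // j jS.
by apply: vx; rewrite inE (xP i).2.
Qed.

(** The leading block of the OHCP matrix is the identity, so placing a chain in the first block of
    coordinates solves the system. *)
Lemma ohcp_mx_right_inverse (R : realType) (V : finType)
    (K : oriented_complex V) (p : nat) :
  map_mx intr (ohcp_mx K p) *m col_mx (col_mx 1%:M 0) (col_mx 0 0)
  = 1%:M :> 'M[R]_#|psimplices K p|.
Proof.
by rewrite /ohcp_mx !map_row_mx !mul_row_col map_mx1 mul1mx !mulmx0 !addr0.
Qed.

Theorem lemma4p3 (R : realType) (V : finType) (K : oriented_complex V)
    (p q : nat) (q_eq : q = p.+1) (q_dim : (1 <= q <= complex_dim K)%N)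
    (w : 'cV[R]_#|psimplices K p|) (w_ge0 : forall i, 0 <= w i 0) :
  ((exists c : 'cV[R]_#|psimplices K p|,
      c \is a mxOver Num.int /\
      has_nonintegral_basic_solution (ohcp_lp w c))
   <->
   (exists i : 'I_#|psimplices K p|,
      has_nonintegral_basic_solution (ohcp_unit_lp w i)))
  /\
  (forall c : 'cV[R]_#|psimplices K p|,
     c \is a mxOver Num.int ->
     has_nonintegral_basic_solution (ohcp_lp w c) ->
     exists i : 'I_#|psimplices K p|,
       c i 0 != 0 /\ has_nonintegral_basic_solution (ohcp_unit_lp w i)).
Proof.
have unit_lp (c : 'cV[R]_#|psimplices K p|) : c \is a mxOver Num.int ->
    has_nonintegral_basic_solution (ohcp_lp w c) ->
    exists i : 'I_#|psimplices K p|,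
      c i 0 != 0 /\ has_nonintegral_basic_solution (ohcp_unit_lp w i).
  exact/nonintegral_basic_solution_unit/ohcp_mx_right_inverse.
split=> //; split=> [[c [c_int /(unit_lp c c_int)[i [_ Hi]]]]|[i Hi]].
  by exists i.
exists (delta_mx i 0); split=> //.
by apply/mxOverP => j k; rewrite mxE rpred_nat.
Qed.
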